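(* Let $A$ be a unital associative algebra over a finite field of characteristic $p>0$. Suppose $L\subseteq A$ is a Lie subalgebra of $A$ (with respect to $[a,b]=ab-ba$) consisting of nilpotent elements of $A$. If $A^\times$ is either solvable or bounded Engel, then the associative subalgebra $S$ of $A$ generated by $L$ is locally nilpotent.
   Context: $A^\times$ is the group of multiplicative units of $A$. For group elements, $(x,y)=x^{-1}y^{-1}xy$; a group is bounded Engel if, for some fixed $n\ge 1$, it satisfies the (left-normed) group identity $(x,y,\ldots,y)=1$ with $n$ occurrences of $y$. The associative subalgebra generated by $L$ is the non-unital one (the span of all nonempty products of elements of $L$). An algebra is locally nilpotent if every finitely generated (not necessarily unital) subalgebra of it is nilpotent. *)

(* Defs.v *)
From HB Require Import structures.
From mathcomp Require Import all_boot all_order all_algebra.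
From mathcomp Require Import boolp classical_sets.

Set Implicit Arguments.
Unset Strict Implicit.
Unset Printing Implicit Defensive.

Import GRing.Theory.
Local Open Scope classical_set_scope.
Local Open Scope ring_scope.

(* [algType] does not provide a decidable unit predicate, so a unit is stored
   together with its (unique) two-sided inverse. *)
Section Units.
Variable A : pzRingType.

Record units := Units {
  unit_pair : A * A;
  _ : (unit_pair.1 * unit_pair.2 == 1) && (unit_pair.2 * unit_pair.1 == 1)
}.

HB.instance Definition _ := [isSub for unit_pair].
HB.instance Definition _ := [Choice of units by <:].

Implicit Types u v w : units.

Lemma units_mulP u v :
  ((val u).1 * (val v).1 * ((val v).2 * (val u).2) == 1) &&
  ((val v).2 * (val u).2 * ((val u).1 * (val v).1) == 1).
Proof.
case: u v => [[a a'] /= /andP[/eqP aa' /eqP a'a]].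
move=> [[b b'] /= /andP[/eqP bb' /eqP b'b]].
by rewrite mulrA -(mulrA a) bb' mulr1 aa' eqxx mulrA -(mulrA b') a'a mulr1 b'b
  eqxx.
Qed.

Lemma units_oneP : (1 * 1 == 1 :> A) && (1 * 1 == 1 :> A).
Proof. by rewrite mulr1 eqxx. Qed.

Lemma units_invP u :
  ((val u).2 * (val u).1 == 1) && ((val u).1 * (val u).2 == 1).
Proof. by rewrite andbC; apply: (valP u). Qed.

Definition units_mul u v : units :=
  @Units ((val u).1 * (val v).1, (val v).2 * (val u).2) (units_mulP u v).
Definition units_one : units := @Units (1, 1) units_oneP.
Definition units_inv u : units :=
  @Units ((val u).2, (val u).1) (units_invP u).

Lemma units_mulA : associative units_mul.
Proof. by move=> u v w; apply: val_inj; rewrite /= !mulrA. Qed.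

Lemma units_mul1 : left_id units_one units_mul.
Proof.
by move=> u; apply: val_inj; rewrite /= mul1r mulr1; case: (unit_pair u).
Qed.

Lemma units_mulr1 : right_id units_one units_mul.
Proof.
by move=> u; apply: val_inj; rewrite /= mul1r mulr1; case: (unit_pair u).
Qed.

Lemma units_mulV : left_inverse units_one units_inv units_mul.
Proof.
by move=> u; apply: val_inj => /=; case/andP: (valP u) => _ /eqP ->.
Qed.

Lemma units_mulrV : right_inverse units_one units_inv units_mul.
Proof.
by move=> u; apply: val_inj => /=; case/andP: (valP u) => /eqP ->.
Qed.

HB.instance Definition _ := isGroup.Build units
  units_mulA units_mul1 units_mulr1 units_mulV units_mulrV.

End Units.

Section Groups.
Variable G : groupType.
Local Open Scope group_scope.

Definition is_subgroup (H : set G) : Prop :=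
  [/\ H 1, forall x y, H x -> H y -> H (x * y) & forall x, H x -> H x^-1].

Definition subgroup_gen (X : set G) : set G := smallest is_subgroup X.

Fixpoint derived_series (n : nat) : set G :=
  if n is m.+1 then
    subgroup_gen
      [set z | exists x y,
        [/\ derived_series m x, derived_series m y & z = [~ x, y]]]
  else setT.

Definition solvable_group : Prop := exists n, derived_series n = [set 1].

Definition engel_word (n : nat) (x y : G) : G :=
  iter n (fun z => [~ z, y]) x.

Definition bounded_engel : Prop :=
  exists2 n : nat, (0 < n)%N & forall x y : G, engel_word n x y = 1.

End Groups.

Section Algebras.
Variables (F : fieldType) (A : algType F).

Definition is_subspace (V : set A) : Prop :=
  [/\ V 0, forall x y, V x -> V y -> V (x + y)
    & forall (c : F) x, V x -> V (c *: x)].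

Definition is_lie_subalgebra (L : set A) : Prop :=
  is_subspace L /\ forall x y, L x -> L y -> L (x * y - y * x).

Definition nilpotent_elt (x : A) : Prop := exists n : nat, x ^+ n = 0.

(* Not necessarily unital: only nonempty products are allowed. *)
Definition assoc_gen (X : set A) : set A :=
  [set x | exists (m : nat) (c : 'I_m -> F) (w : 'I_m -> seq A),
    (forall i, w i <> [::] /\ (forall a, a \in w i -> X a)) /\
    x = \sum_(i < m) c i *: \prod_(a <- w i) a].

Definition finitely_generated (B : set A) : Prop :=
  exists s : seq A, B = assoc_gen [set` s].

Definition nilpotent_subalg (B : set A) : Prop :=
  exists2 n : nat, (0 < n)%N &
    forall w : seq A, size w = n -> (forall a, a \in w -> B a) ->
      \prod_(a <- w) a = 0.

Definition locally_nilpotent (S : set A) : Prop :=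
  forall B : set A, B `<=` S -> finitely_generated B -> nilpotent_subalg B.

End Algebras.

(* Main.v *)
Require Import Defs.
From mathcomp Require Import all_boot all_order all_algebra.
From mathcomp Require Import boolp classical_sets.

Set Implicit Arguments.
Unset Strict Implicit.
Unset Printing Implicit Defensive.

Import GRing.Theory.
Local Open Scope classical_set_scope.
Local Open Scope ring_scope.

(* Let I be the intersection of all semiprime ideals of A; it is semiprime and
   nil, so units of A/I lift to A.  Suppose all words of length k+1 over some set
   X lie in I, and let w be a word of length k.  Splitting w at every position
   gives elements q_i = w_{>=i} x_i w_{<=i} that multiply modulo I like the
   superdiagonal entries of a generic unitriangular matrix, and
   [1 + x, 1 + y] = 1 + xy whenever yx = x^2 = 0.  Iterated commutators of units
   1 + q_i therefore have value 1 + q_0 ... q_r modulo I, so that a solvability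
   or Engel condition forces w x_0 w x_1 ... w in I for all x_i, hence w in I, as
   soon as k is large.  Thus nilpotency degrees modulo I are bounded by a fixed
   K, which makes the Engel-Jacobson argument work for L in infinite dimension:
   a maximal bracket-closed subset of L with nilpotent envelope is all of L.
   Finally, a finite set whose words of length K lie in I generates a nilpotent
   algebra, since otherwise an ideal maximal among those containing no full
   power of it would be semiprime. *)

(** * Chains of sets and Zorn's lemma *)

Lemma total_bigcup_seq (T : eqType) (C : set (set T)) (s : seq T) :
  C !=set0 -> total_on C subset ->
  (forall a, a \in s -> (\bigcup_(X in C) X) a) ->
  exists2 X, C X & forall a, a \in s -> X a.
Proof.
move=> [X0 CX0] totC; elim: s => [|a s IHs] sC; first by exists X0.
have [b sb|X CX sX] := IHs; first by apply: sC; rewrite inE sb orbT.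
have [Y CY Ya] := sC a (mem_head a s).
have [XY|YX] := totC _ _ CX CY.
- exists Y => // b; rewrite inE => /predU1P[-> //|/sX]; exact: XY.
- exists X => // b; rewrite inE => /predU1P[-> //|/sX //]; exact: YX.
Qed.

(** [Zorn_bigcup] also ranges over the empty chain, so it is applied to the sets whose union with
    [A0] satisfies [P]; the empty chain then falls under [P A0]. *)
Lemma Zorn_above (T : Type) (P : set (set T)) (A0 : set T) :
  P A0 ->
  (forall C : set (set T), C !=set0 -> C `<=` P -> total_on C subset ->
     P (\bigcup_(X in C) X)) ->
  exists M, [/\ P M, A0 `<=` M & forall B, M `<=` B -> P B -> B `<=` M].
Proof.
move=> PA0 chainP.
have [|M [PM maxM]] := @Zorn_bigcup T [set X | P (A0 `|` X)].
  move=> C CP totC /=; have [[X CX]|C0] := pselect (C !=set0); last first.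
    by rewrite (_ : \bigcup_(X in C) X = set0) ?setU0 // -subset0 => x [X CX _];
      case: C0; exists X.
  rewrite (_ : _ `|` _ = \bigcup_(Y in [set A0 `|` X | X in C]) Y).
    apply: chainP; first by exists (A0 `|` X), X.
      by move=> _ [Y CY <-]; apply: CP.
    move=> _ _ [Y CY <-] [Z CZ <-].
    by case: (totC Y Z CY CZ) => YZ; [left|right]; apply: setUS.
  apply/seteqP; split=> x.
    by case=> [A0x|[Y CY Yx]]; [exists (A0 `|` X) => //; [exists X|left]
      |exists (A0 `|` Y); [exists Y|right]].
  by case=> _ [Y CY <-] [A0x|Yx]; [left|right; exists Y].
exists (A0 `|` M); split=> // B MB PB b Bb.
apply: contrapT => nb; apply: (maxM B).
  split; first by apply: subset_trans MB.
  by move=> BM; apply: nb; right; apply: BM.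
by rewrite /= setUidr // => x A0x; apply: MB; left.
Qed.

(** * Two-sided ideals and the prime radical *)

Section Ideals.
Variable A : pzRingType.
Implicit Types (I J X Y : set A) (x y z a b : A) (u v w s : seq A).

Definition is_ideal I : Prop :=
  [/\ I 0, forall x y, I x -> I y -> I (x + y),
      forall a x, I x -> I (a * x) & forall a x, I x -> I (x * a)].

Definition semiprime I : Prop := forall x, (forall a, I (x * a * x)) -> I x.

Definition words_in X I (n : nat) : Prop :=
  forall w, size w = n -> (forall a, a \in w -> X a) -> I (\prod_(a <- w) a).

Section IdealTheory.
Variable I : set A.
Hypothesis idI : is_ideal I.

Lemma ideal0 : I 0. Proof. by case: idI. Qed.
Lemma idealD x y : I x -> I y -> I (x + y).
Proof. by case: idI => _ +_ _; exact. Qed.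
Lemma idealMl a x : I x -> I (a * x).
Proof. by case: idI => _ _ + _; exact. Qed.
Lemma idealMr a x : I x -> I (x * a).
Proof. by case: idI => _ _ _; exact. Qed.
Lemma idealN x : I x -> I (- x).
Proof. by rewrite -mulN1r; apply: idealMl. Qed.
Lemma idealB x y : I x -> I y -> I (x - y).
Proof. by move=> Ix Iy; apply/idealD/idealN. Qed.

Lemma ideal_eqC x y : I (x - y) -> I (y - x).
Proof. by move=> /idealN; rewrite opprB. Qed.
Lemma ideal_trans y x z : I (x - y) -> I (y - z) -> I (x - z).
Proof. by move=> xy /(idealD xy); rewrite addrA subrK. Qed.
Lemma ideal_eqM x y a b : I (x - y) -> I (a - b) -> I (x * a - y * b).
Proof.
move=> xy ab; rewrite (_ : _ - _ = (x - y) * a + y * (a - b)).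
  by apply: idealD; [apply: idealMr|apply: idealMl].
by rewrite mulrBl mulrBr addrA subrK.
Qed.
Lemma ideal_eq x y : I (x - y) -> I y -> I x.
Proof. by move=> xy /(idealD xy); rewrite subrK. Qed.

Lemma words_in_le X m n : (m <= n)%N -> words_in X I m -> words_in X I n.
Proof.
move=> le_mn Xm w sw Xw; rewrite -(cat_take_drop m w) big_cat /=.
apply/idealMr/Xm => [|a /mem_take]; last exact: Xw.
by rewrite size_takel ?sw.
Qed.

End IdealTheory.

Lemma is_ideal0 : is_ideal [set 0].
Proof.
split=> //= [x y -> ->|a x ->|a x ->]; by rewrite ?addr0 ?mulr0 ?mul0r.
Qed.

(** A finite alphabet has finitely many words of a given length, so if they all lie in the union of
    a chain of ideals, they all lie in one member. *)
Lemma words_list s n : exists l : seq A,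
  (forall z, z \in l -> exists w, [/\ size w = n, (forall a, a \in w -> a \in s)
     & z = \prod_(a <- w) a]) /\
  (forall w, size w = n -> (forall a, a \in w -> a \in s) ->
     \prod_(a <- w) a \in l).
Proof.
elim: n => [|n [l [lw wl]]].
  exists [:: 1]; split=> [z|[]//]; last by rewrite big_nil mem_head.
  by rewrite inE => /eqP ->; exists [::]; rewrite big_nil.
exists [seq a * z | a <- s, z <- l]; split.
  move=> _ /allpairsP[[a z] /= [sa /lw[w [sw ws ->]] ->]].
  exists (a :: w); rewrite big_cons /= sw; split=> // b.
  by rewrite inE => /predU1P[->|/ws].
case=> // a w [sw] ws; rewrite big_cons; apply/allpairsP.
exists (a, \prod_(b <- w) b); split=> //=; first exact/ws/mem_head.
by apply: wl => // b bw; apply: ws; rewrite inE bw orbT.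
Qed.

Lemma exists_semiprime s : ~ (exists n, words_in [set` s] [set 0] n) ->
  exists J, [/\ is_ideal J, semiprime J & ~ exists n, words_in [set` s] J n].
Proof.
move=> nil_s.
pose P J := is_ideal J /\ ~ exists n, words_in [set` s] J n.
have [||J [[idJ Js] _ maxJ]] := @Zorn_above A P [set 0].
- by split=> //; apply: is_ideal0.
- move=> C C0 CP totC.
  have chain t := @total_bigcup_seq _ C t C0 totC.
  split; last first.
    case=> n Un; have [l [lw wl]] := words_list s n.
    have [z /lw[w [sw ws ->]]|X CX lX] := chain l; first exact: Un.
    by case: (CP X CX) => _; case; exists n => w sw ws; apply/lX/wl.
  split.
  + by case: C0 => X CX; exists X => //; case: (CP X CX) => /ideal0.
  + move=> x y Ux Uy; have [|X CX xyX] := chain [:: x; y].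
      by move=> a; rewrite !inE => /orP[]/eqP->.
    have [idX _] := CP X CX; exists X => //.
    by apply: (idealD idX); apply: xyX; rewrite !inE eqxx ?orbT.
  + move=> a x [X CX Xx]; have [idX _] := CP X CX.
    by exists X => //; apply: idealMl.
  + move=> a x [X CX Xx]; have [idX _] := CP X CX.
    by exists X => //; apply: idealMr.
exists J; split=> // x xAx; apply: contrapT => nJx.
(* Both [x] and [J] lie in [ann [set x]], so long words lie there; then [x] and
   [J] lie in the annihilator of these words. *)
pose ann Y := [set z | forall y a, Y y -> J (y * a * z) /\ J (z * a * y)].
have ann_words Y : ann Y x -> exists n, words_in [set` s] (ann Y) n.
  move=> Yx; apply: contrapT => annY; apply: nJx.
  apply: (maxJ (ann Y)) => // [z Jz y a _|].
    by split; [apply: (idealMl idJ)|rewrite -mulrA; apply: (idealMr idJ)].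
  split=> //; split.
  - by move=> y a _; rewrite mulr0 !mul0r; split; apply: ideal0.
  - move=> z z' Jz Jz' y a Yy; rewrite mulrDr !mulrDl.
    by split; apply: idealD => //; case: (Jz y a Yy); case: (Jz' y a Yy).
  - move=> b z Jz y a Yy; split.
      by rewrite mulrA -(mulrA y); case: (Jz y (a * b) Yy).
    by rewrite -(mulrA b) -(mulrA b); apply: idealMl => //; case: (Jz y a Yy).
  - move=> b z Jz y a Yy; split.
      by rewrite mulrA; apply: idealMr => //; case: (Jz y a Yy).
    by rewrite -(mulrA z); case: (Jz y (b * a) Yy).
have [|m xm] := ann_words [set x]; first by move=> y a ->; split; apply: xAx.
pose Y w := size w = m /\ forall a, a \in w -> a \in s.
have [|n yn] := ann_words [set \prod_(a <- w) a | w in Y].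
  move=> _ a [w [sw ws] <-].
  by have [] := xm w sw ws x a (erefl x).
apply: Js; exists (m + n)%N => w sw ws.
rewrite -(cat_take_drop m w) big_cat /= -[X in X * _]mulr1.
have tw : Y (take m w).
  by split=> [|a /mem_take/ws//]; rewrite size_takel ?sw ?leq_addr.
have dw a : a \in drop m w -> [set` s] a by move=> /mem_drop/ws.
have sd : size (drop m w) = n by rewrite size_drop sw addKn.
have tY : [set \prod_(a <- w) a | w in Y] (\prod_(a <- take m w) a).
  by exists (take m w).
by have [] := yn (drop m w) sd dw _ 1 tY.
Qed.

(** This is the prime radical (Baer's lower nilradical), the least semiprime ideal. *)
Definition semiprime_core : set A :=
  [set x | forall J, is_ideal J -> semiprime J -> J x].

Lemma ideal_core : is_ideal semiprime_core.
Proof.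
split.
- by move=> J idJ _; apply: ideal0.
- by move=> x y Ix Iy J idJ sJ; apply: idealD => //; [apply: Ix|apply: Iy].
- by move=> a x Ix J idJ sJ; apply: idealMl => //; apply: Ix.
- by move=> a x Ix J idJ sJ; apply: idealMr => //; apply: Ix.
Qed.

Lemma semiprime_coreP : semiprime semiprime_core.
Proof. by move=> x Ix J idJ sJ; apply: (sJ) => a; apply: Ix. Qed.

Lemma words_in_core s n : words_in [set` s] semiprime_core n ->
  exists m, words_in [set` s] [set 0] m.
Proof.
move=> In; apply: contrapT => /exists_semiprime[J [idJ sJ]]; apply.
by exists n => w sw ws; apply: In.
Qed.

Lemma core_nil x : semiprime_core x -> exists n, x ^+ n = 0.
Proof.
move=> Ix; have [|n x0] := @words_in_core [:: x] 1.
  case=> // a [|//] _ xa; rewrite big_seq1.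
  by have := xa a (mem_head _ _); rewrite /= inE => /eqP->.
exists n; have := x0 (nseq n x); rewrite big_nseq iter_mulr_1 => -> //.
  exact: size_nseq.
by move=> a /nseqP[-> _]; rewrite /= inE.
Qed.

Lemma prefix_core I w r :
  is_ideal I -> semiprime I -> let z := \prod_(a <- w) a in
  (forall f : nat -> A, I ((\prod_(0 <= i < r) (z * f i)) * z)) -> I z.
Proof.
move=> idI sI z; elim: r => [|r IHr] If.
  by have := If (fun=> 0); rewrite big_geq // mul1r.
apply: IHr => f; apply: sI => a.
(* For [g] the alternating product of length [r], [g * a * g] is in [I]: the second [g] starts with
   [z], so [g * a * z] is the alternating product of length [r.+1] with [a] as its last filler. *)
have [t tE] : exists t, (\prod_(0 <= i < r) (z * f i)) * z = z * t.
  case: (r) => [|r']; first by exists 1; rewrite big_geq // mul1r mulr1.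
  by rewrite big_nat_recl // -!mulrA; eexists.
rewrite {2}tE [_ * (z * t)]mulrA; apply: idealMr => //.
have := If (fun i => if i == r then a else f i).
rewrite big_nat_recr //= eqxx (eq_big_nat _ _ (F2 := fun i => z * f i)).
  by rewrite !mulrA.
by move=> i /andP[_ ir]; rewrite ltn_eqF.
Qed.

End Ideals.

(** * Unipotent units and their commutators modulo an ideal *)

Section Units.
Variable A : pzRingType.
Implicit Types (I : set A) (x y q : A) (u v : units A).

Lemma unipotent_unit x n : x ^+ n = 0 -> exists u : units A, (val u).1 = 1 + x.
Proof.
move=> xn0; pose y := \sum_(i < n) (- x) ^+ i.
have xy : (1 + x) * y = 1.
  have := subrX1 (- x) n; rewrite exprNn xn0 mulr0 sub0r -opprD mulNr.
  by move/oppr_inj; rewrite addrC => <-.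
have yx : y * (1 + x) = 1.
  have <- : GRing.comm (1 + x) y; last by [].
  apply: commr_sum => i _; apply/commrX/commrN/commr_sym/commrD => //.
  exact: commr1.
have P : ((1 + x) * y == 1) && (y * (1 + x) == 1) by rewrite xy yx eqxx.
by exists (@Units _ (1 + x, y) P).
Qed.

(* Both sides agree after multiplication by [v * u] on the left. *)
Lemma commutator_one_plus I u v x y : is_ideal I ->
  I (y * x) -> I (x * x) -> I ((val u).1 - (1 + x)) -> I ((val v).1 - (1 + y)) ->
  I ((val [~ u, v]%g).1 - (1 + x * y)).
Proof.
move=> idI yx xx ux vy.
have -> : (val [~ u, v]%g).1 =
    (val u).2 * ((val v).2 * ((val u).1 * (val v).1)) by [].
have /andP[_ /eqP u1] := valP u; have /andP[_ /eqP v1] := valP v.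
have vu1 : (val u).2 * ((val v).2 * ((val v).1 * (val u).1)) = 1.
  by rewrite (mulrA (val v).2) v1 mul1r u1.
set c := 1 + x * y.
have cE : c = (val u).2 * ((val v).2 * ((val v).1 * (val u).1 * c)).
  by rewrite [(val v).2 * (_ * c)]mulrA [(val u).2 * (_ * c)]mulrA vu1 mul1r.
rewrite [X in _ - X]cE -!mulrBr; do 2!apply: idealMl => //.
apply: (ideal_trans idI (ideal_eqM idI ux vy)).
apply: ideal_eqC => //.
have := ideal_eqM idI (ideal_eqM idI vy ux) (_ : I (c - c)).
rewrite subrr => /(_ (ideal0 idI)) /ideal_trans; apply=> //.
rewrite (_ : _ - _ = y * x + x * x * y + y * x * y + y * x * (x * y)).
  by do 3![apply: (idealD idI); last by apply: (idealMr idI)].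
apply/eqP; rewrite subr_eq; apply/eqP.
rewrite !(mulrDl, mulrDr, mul1r, mulr1, mulrA).
by rewrite [LHS](AC ((2*2)*(2*2)) (4*6*7*8*(1*3*(2*5)))).
Qed.

End Units.

(** * Bounding nilpotency degrees by a group identity *)

Section NilpotencyBound.
Variables (A : pzRingType) (I X : set A) (k : nat).
Hypotheses (idI : is_ideal I) (sI : semiprime I).
Hypothesis nilI : forall x, I x -> exists n, x ^+ n = 0.
Hypothesis Xk : words_in X I k.+1.

(** Since [I] is nil, nilpotency modulo [I] is nilpotency in [A], which yields genuine units of
    [A]. *)
Lemma nil_mod_unit x n : I (x ^+ n) -> exists u : units A, (val u).1 = 1 + x.
Proof. by move=> /nilI[m]; rewrite -exprM; apply: unipotent_unit. Qed.

Section Word.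
Variables (w : seq A) (f : nat -> A).
Hypotheses (sw : size w = k) (Xw : forall a, a \in w -> X a).

(* Modulo [I] these behave like the superdiagonal entries of a strictly upper
   triangular matrix: a product of consecutive ones is unconstrained, whereas
   [q i * q j] contains a word of length at least [k.+1] when [j <= i]. *)
Let q i := (\prod_(a <- drop i w) a) * f i * \prod_(a <- take i.+1 w) a.

Lemma superdiag_mul_in i j : (j <= i < k)%N -> I (q i * q j).
Proof.
move=> /andP[ji ik]; rewrite /q -!mulrA; do 2!apply: idealMl => //.
rewrite mulrA -big_cat; apply: idealMr => //.
have le_k : (k.+1 <= i.+1 + (k - j))%N.
  by rewrite addSn ltnS -{1}(subnK (leq_trans ji (ltnW ik))) addnC leq_add2r.
apply: (words_in_le idI le_k Xk) => [|a].
  by rewrite size_cat size_takel ?size_drop sw.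
by rewrite mem_cat => /orP[/mem_take|/mem_drop]; apply: Xw.
Qed.

(** The prefix closing [q i] and the suffix opening [q i.+1] join to a full copy of [w]. *)
Lemma superdiag_prod r : \prod_(0 <= i < r) q i =
  (\prod_(0 <= i < r) ((\prod_(a <- w) a) * f i)) * \prod_(a <- take r w) a.
Proof.
elim: r => [|r IHr]; first by rewrite !big_geq // take0 big_nil mulr1.
rewrite !big_nat_recr //= IHr /q -!mulrA; congr (_ * _).
by rewrite !mulrA -big_cat /= cat_take_drop.
Qed.

(** The two factors meeting in the middle are [q b.-1] and [q c], in the wrong order. This covers
    both hypotheses of [commutator_one_plus]. *)
Lemma superdiag_prod_mul_in a b c d :
  (a < b <= k)%N -> (c < d)%N -> (c < b)%N ->
  I ((\prod_(a <= i < b) q i) * \prod_(c <= i < d) q i).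
Proof.
case: b => // b /andP[ab bk] cd cb.
rewrite big_nat_recr //= (big_ltn cd) mulrA -(mulrA _ (q b)).
by apply/(idealMr idI)/(idealMl idI)/superdiag_mul_in; rewrite -ltnS cb.
Qed.

(** Each derived step takes the commutator of the units of two adjacent blocks, doubling the block
    length. *)
Lemma derived_superdiag_prod m a : (a + 2 ^ m <= k)%N ->
  exists2 u : units A, derived_series m u &
    I ((val u).1 - (1 + \prod_(a <= i < a + 2 ^ m) q i)).
Proof.
elim: m a => [|m IHm] a.
  rewrite expn0 addn1 => ak; rewrite big_nat1.
  have [|u uE] := @nil_mod_unit (q a) 2.
    by rewrite expr2; apply: superdiag_mul_in; rewrite leqnn.
  by exists u => //; rewrite uE subrr; apply: ideal0.
rewrite expnS mul2n -addnn addnA => ak.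
have lt_a b : (b < b + 2 ^ m)%N by rewrite -{1}(addn0 b) ltn_add2l expn_gt0.
have ak1 := leq_trans (leq_addr _ _) ak.
have [u Du uE] := IHm a ak1; have [v Dv vE] := IHm _ ak.
exists [~ u, v]%g; first by move=> H [_]; apply; exists u, v.
rewrite (@big_cat_nat _ _ _ (a + 2 ^ m)) ?leq_addr //=.
by apply: commutator_one_plus => //; apply: superdiag_prod_mul_in;
  rewrite ?lt_a ?ak ?ak1 //; apply: ltn_trans (lt_a _).
Qed.

(** As for a nilpotent Jordan block: modulo [I] only strictly increasing products survive in a power
    of [s], and [m] indices admit one of length [m] and none longer. *)
Lemma superdiag_sum_exp m a : (a + m <= k)%N ->
  let s := \sum_(a <= i < a + m) q i in
  I (s ^+ m - \prod_(a <= i < a + m) q i) /\ I (s ^+ m.+1).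
Proof.
elim: m a => [|m IHm] a; rewrite ?addn0 => ak /=.
  by rewrite !big_geq // expr0n subrr; split; apply: ideal0.
have am : (a < a + m.+1)%N by rewrite addnS ltnS leq_addr.
rewrite !(big_ltn am) -addSnnS; set s := \sum_(_ <= i < _) q i.
have [|sm sm1] := IHm a.+1; first by rewrite addSnnS.
have qsq : I ((q a + s) * q a).
  rewrite mulrDl; apply: idealD => //.
    by apply: superdiag_mul_in; rewrite leqnn (leq_trans am).
  rewrite mulr_suml big_nat; apply: (big_ind I) => [||i]; first exact: ideal0.
    exact: idealD.
  move=> /andP[ai im]; apply: superdiag_mul_in.
  by rewrite ltnW //= (leq_trans im) // addSnnS.
(* By [qsq], [q a] can survive only as the leftmost factor. *)
have expE l : I ((q a + s) ^+ l.+1 - (q a * s ^+ l + s ^+ l.+1)).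
  elim: l => [|l IHl]; first by rewrite !expr1 expr0 mulr1 subrr; apply: ideal0.
  rewrite exprS [s ^+ l.+2]exprS -mulrDl.
  apply: (ideal_trans idI (ideal_eqM idI (_ : I (_ - (q a + s))) IHl)).
    by rewrite subrr; apply: ideal0.
  by rewrite mulrDr addrK mulrA; apply: idealMr.
split.
  apply: (ideal_trans idI (expE m)); rewrite addrAC -mulrBr.
  by apply: idealD => //; apply: idealMl.
apply: (ideal_eq idI (expE _)); apply: idealD => //; first exact: idealMl.
by rewrite exprS; apply: idealMl.
Qed.

Lemma engel_superdiag_prod n : (n < k)%N ->
  (forall x y : units A, engel_word n x y = 1%g) ->
  I (\prod_(0 <= i < n.+1) q i).
Proof.
move=> nk engel; have [sn sn1] := @superdiag_sum_exp n 1 nk.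
set s := \sum_(_ <= i < _) _ in sn sn1.
have q0q0 : I (q 0 * q 0) by apply: superdiag_mul_in; rewrite (leq_trans _ nk).
have sq0 : I (s * q 0).
  rewrite mulr_suml big_nat; apply: (big_ind I) => [||i]; first exact: ideal0.
    exact: idealD.
  move=> /andP[_ ik]; apply: superdiag_mul_in.
  exact: leq_trans ik nk.
have [u uE] : exists u : units A, (val u).1 = 1 + q 0.
  by apply: (@nil_mod_unit _ 2); rewrite expr2.
have [v vE] := nil_mod_unit sn1.
(* Both conditions of the commutator formula reduce to [s * q 0] and [q 0 * q 0] lying in [I]. *)
have wordE m : I ((val (engel_word m u v)).1 - (1 + q 0 * s ^+ m)).
  elim: m => [|m IHm]; first by rewrite /= uE mulr1 subrr; apply: ideal0.
  rewrite exprSr mulrA; apply: commutator_one_plus => //.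
  - by rewrite mulrA; apply: idealMr.
  - case: m {IHm} => [|m]; first by rewrite mulr1.
    rewrite {1}exprSr (mulrA (q 0) _ s) -(mulrA _ s); apply: idealMl => //.
    by rewrite (mulrA s); apply: idealMr.
  - by rewrite vE subrr; apply: ideal0.
have /= := wordE n; rewrite engel /= opprD addNKr => /(idealN idI).
rewrite opprK big_ltn // => q0sn.
rewrite add1n in sn; apply: (ideal_eq idI _ q0sn).
by rewrite -mulrBr; apply: (idealMl idI); apply: (ideal_eqC idI).
Qed.

End Word.

(** Right multiplication by [drop r w] completes the product to the alternating one of
    [prefix_core]. *)
Lemma superdiag_words_in r :
  (forall w f, size w = k -> (forall a, a \in w -> X a) ->
    I (\prod_(0 <= i < r)
        ((\prod_(a <- drop i w) a) * f i * \prod_(a <- take i.+1 w) a))) ->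
  words_in X I k.
Proof.
move=> Iq w sw Xw; apply: (prefix_core idI sI (r := r)) => f.
rewrite -{2}(cat_take_drop r w) big_cat /= mulrA -superdiag_prod //.
exact/(idealMr idI)/Iq.
Qed.

End NilpotencyBound.

Lemma group_identity_bound (A : pzRingType) (I : set A) :
  is_ideal I -> semiprime I -> (forall x, I x -> exists n, x ^+ n = 0) ->
  solvable_group (units A) \/ bounded_engel (units A) ->
  exists K, forall X n, words_in X I n -> words_in X I K.
Proof.
move=> idI sI nilI GI.
(* A threshold independent of [X] suffices: any degree above it can be lowered by one repeatedly. *)
suff [K XK] : exists K, forall X k, (K <= k)%N -> words_in X I k.+1 ->
    words_in X I k.
  exists K => X; elim=> [|n IHn] Xn; first exact: words_in_le Xn.
  have [le_Kn|lt_nK] := leqP K n; first exact/IHn/XK.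
  exact: words_in_le Xn.
case: GI => [[n Gn]|[n _ Gn]].
- exists (2 ^ n)%N => X k nk Xk; apply: (@superdiag_words_in _ _ _ _ idI sI (2 ^ n)) => //.
  move=> w f sw Xw.
  have [//|u] := derived_superdiag_prod idI nilI Xk f sw Xw (m := n) (a := 0).
  rewrite Gn => ->; rewrite /= add0n opprD addNKr => /(idealN idI).
  by rewrite opprK.
- exists n.+1 => X k nk Xk; apply: (@superdiag_words_in _ _ _ _ idI sI n.+1) => //.
  by move=> w f sw Xw; exact: (engel_superdiag_prod idI nilI Xk f sw Xw nk Gn).
Qed.

(** * Colons of an ideal by words *)

Section Cowords.
Variables (A : pzRingType) (I X : set A).
Hypothesis idI : is_ideal I.

(* The colon of [I] by the words of length [n]: it grows from [I] at [n = 0] to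
   the whole ring once all words of length [n] lie in [I]. *)
Definition cowords (n : nat) : set A :=
  [set z | forall u : seq A, size u = n -> (forall a, a \in u -> X a) ->
     I ((\prod_(a <- u) a) * z)].

Lemma cowords0 z : cowords 0 z <-> I z.
Proof.
split=> [/(_ [::])|Iz u _ _]; last exact: idealMl.
by rewrite big_nil mul1r; apply.
Qed.

Lemma cowords1 n : cowords n 1 <-> words_in X I n.
Proof. by split=> Xn w sw Xw; have := Xn w sw Xw; rewrite mulr1. Qed.

Lemma cowords_add n x y : cowords n x -> cowords n y -> cowords n (x + y).
Proof.
by move=> nx ny u su Xu; rewrite mulrDr; apply: idealD; [|apply: nx|apply: ny].
Qed.

Lemma cowordsMr n x y : cowords n x -> cowords n (x * y).
Proof.
by move=> nx u su Xu; rewrite mulrA; apply: (idealMr idI); apply: nx.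
Qed.

Lemma cowords_nil n : cowords n 0.
Proof. by move=> u _ _; rewrite mulr0; apply: ideal0. Qed.

Lemma cowordsMl n a z : X a -> cowords n.+1 z -> cowords n (a * z).
Proof.
move=> Xa nz u su Xu; have := nz (rcons u a); rewrite -cats1 big_cat big_seq1.
rewrite /= mulrA; apply=> [|b]; first by rewrite size_cat su addn1.
by rewrite mem_cat inE => /orP[/Xu|/eqP->].
Qed.

Lemma cowordsS n z : cowords n z -> cowords n.+1 z.
Proof.
move=> nz [|a u] //= [su] Xu; rewrite big_cons -mulrA; apply: (idealMl idI); apply: nz => //.
by move=> b bu; apply: Xu; rewrite inE bu orbT.
Qed.

(** Move [x] leftwards through the word: each exchange leaves a commutator that is again a letter,
    in a word of the same length [n], and once [x] is in front the word meets [z] directly. *)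
Lemma cowordsM_normal n x z :
  (forall a, X a -> X (a * x - x * a)) -> cowords n z -> cowords n (x * z).
Proof.
move=> Xx nz u su Xu.
suff: forall v, size (u ++ v) = n -> (forall a, a \in u ++ v -> X a) ->
    I ((\prod_(a <- u) a) * x * (\prod_(a <- v) a) * z).
  by move/(_ [::]); rewrite cats0 big_nil mulr1 mulrA; apply.
elim/last_ind: u {su Xu} => [|u a IHu] v suv Xuv.
  by rewrite big_nil mul1r -mulrA; apply: (idealMl idI); apply: nz.
have -> : (\prod_(b <- rcons u a) b) * x * (\prod_(b <- v) b) * z =
    (\prod_(b <- u ++ a * x - x * a :: v) b) * z +
    (\prod_(b <- u) b) * x * (\prod_(b <- a :: v) b) * z.
  rewrite -cats1 !big_cat /= !big_cons big_nil mulr1 -mulrDl; congr (_ * z).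
  by rewrite mulrBl mulrBr !mulrA subrK.
have sE b : size (u ++ b :: v) = n by rewrite -suv !size_cat size_rcons addnS.
have XE b : X b -> forall c, c \in u ++ b :: v -> X c.
  move=> Xb c; rewrite mem_cat inE orbCA => /predU1P[->//|cuv].
  by apply: Xuv; rewrite mem_cat mem_rcons inE -orbA -mem_cat mem_cat cuv orbT.
have Xa : X a by apply: Xuv; rewrite mem_cat mem_rcons mem_head.
apply: idealD => //; first by apply: nz => //; apply/XE/Xx.
by apply: IHu; rewrite ?sE //; apply: XE.
Qed.

End Cowords.

(** * The Engel-Jacobson argument with a uniform bound *)

Section EngelJacobson.
Variables (A : pzRingType) (I L : set A) (K : nat).
Hypothesis idI : is_ideal I.
Hypothesis boundK : forall X n, words_in X I n -> words_in X I K.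

(** Cut a word of length [K * n] into [K] blocks. A block [x ^+ n] vanishes, and any other contains
    a letter of [M] and lowers the [cowords] level by one, from [K] down to [0]; [boundK] restores
    the length [K]. *)
Lemma words_in_add_normal M x n :
  (forall a, M a -> M (a * x - x * a)) -> x ^+ n = 0 -> words_in M I K ->
  words_in (M `|` [set x]) I K.
Proof.
move=> Mx xn0 MK.
(* Reading [v] from the right, either only [x] has occurred or some letter of [M] has already
   lowered the level. *)
have step v m z : (forall a, a \in v -> (M `|` [set x]) a) ->
    cowords I M m.+1 z ->
    \prod_(a <- v) a = x ^+ size v \/ cowords I M m ((\prod_(a <- v) a) * z).
  move=> + mz; elim: v => [|a v IHv] Mv; first by left; rewrite big_nil.
  have {IHv} := IHv (fun b bv => Mv b (mem_behead (s := a :: v) bv)).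
  rewrite big_cons /= => IHv; case: (Mv a (mem_head _ _)) => [Ma|->].
  - right; rewrite -mulrA; case: IHv => [->|IHv]; apply: cowordsMl => //.
      by elim: (size v) => [|l IHl]; rewrite ?mul1r // exprS -mulrA;
        apply: cowordsM_normal.
    exact: cowordsS.
  - case: IHv => [->|IHv]; first by left; rewrite exprS.
    by right; rewrite -mulrA; apply: cowordsM_normal.
apply: (boundK (n := K * n)) => w.
suff: forall m, (m <= K)%N -> forall w, size w = (m * n)%N ->
    (forall a, a \in w -> (M `|` [set x]) a) ->
    cowords I M (K - m) (\prod_(a <- w) a).
  by move=> /(_ K (leqnn K) w) wK sw Mw; move: (wK sw Mw); rewrite subnn cowords0.
elim=> [|m IHm] mK {}w sw Mw.
  by case: w sw {Mw} => // _; rewrite big_nil subn0; apply/cowords1.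
rewrite -(cat_take_drop n w) big_cat /=.
have := IHm (ltnW mK) (drop n w); rewrite size_drop sw mulSn addKn -(subnSK mK).
move=> /(_ erefl) wm.
have [||wE|//] := step (take n w) (K - m.+1)%N (\prod_(a <- drop n w) a).
- by move=> b /mem_take/Mw.
- by apply: wm => b /mem_drop/Mw.
- by rewrite wE size_takel ?sw ?leq_addr // xn0 mul0r; apply: cowords_nil.
Qed.

Hypothesis L_bracket : forall x y, L x -> L y -> L (x * y - y * x).
Hypothesis L_nil : forall x, L x -> exists n, x ^+ n = 0.

Lemma exists_normalizing M : M `<=` L -> L `&` I `<=` M -> words_in M I K ->
  ~ L `<=` M ->
  exists x, [/\ L x, ~ M x &
    forall a, M a -> M (a * x - x * a) /\ M (x * a - a * x)].
Proof.
move=> ML LIM MK LM; apply: contrapT => no_x.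
(* Each commutator with an element of [M] moves one letter of [M] next to [z],
   so repeated commutators of an element of [L] with [M] end in [I]. *)
pose H s z := forall u v : seq A, (size u + size v)%N = s ->
  (forall a, a \in u ++ v -> M a) ->
  I ((\prod_(a <- u) a) * z * \prod_(a <- v) a).
(* At total length [K.*2], one of the two sides has length at least [K], so any [z] qualifies at the
   start. *)
have descend s : (s <= K.*2)%N -> exists z, [/\ L z, ~ M z & H (K.*2 - s)%N z].
  elim: s => [|s IHs] sK.
    have [y [Ly nMy]] : exists y, L y /\ ~ M y.
      by apply: contrapT => noy; apply: LM => y Ly; apply: contrapT => nMy;
        apply: noy; exists y.
    exists y; split=> // u v; rewrite subn0 => uv Muv.
    have [Ku|uK] := leqP K (size u).
      apply/(idealMr idI)/(idealMr idI)/(words_in_le idI Ku MK) => // a au.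
      by apply: Muv; rewrite mem_cat au.
    have Kv : (K <= size v)%N.
      by rewrite -(leq_add2l K) addnn -uv leq_add2r ltnW.
    apply/(idealMl idI)/(words_in_le idI Kv MK) => // a av.
    by apply: Muv; rewrite mem_cat av orbT.
  have [z [Lz nMz Hz]] := IHs (ltnW sK).
  have [a [Ma nMa]] : exists a,
      M a /\ ~ (M (a * z - z * a) /\ M (z * a - a * z)).
    apply: contrapT => noa; apply: no_x; exists z; split=> // a Ma.
    by apply: contrapT => nMa; apply: noa; exists a.
  have La := ML a Ma.
  have Haz : H (K.*2 - s.+1)%N (a * z - z * a).
    move=> u v uv Muv; rewrite mulrBr mulrBl; apply: (idealB idI).
      have := Hz (rcons u a) v; rewrite -cats1 big_cat big_seq1 /= mulrA; apply.
        by rewrite size_cat addn1 addSn uv subnSK.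
      by move=> b; rewrite -catA mem_cat inE orbCA -mem_cat => /predU1P[->|/Muv].
    have := Hz u (a :: v); rewrite big_cons /= !mulrA; apply.
      by rewrite addnS uv subnSK.
    by move=> b; rewrite mem_cat inE orbCA -mem_cat => /predU1P[->|/Muv].
  (* [M] need not be closed under opposites, so both signs of the bracket are tried. *)
  have [Maz|nMaz] := pselect (M (a * z - z * a)); last first.
    by exists (a * z - z * a); split=> //; apply: L_bracket.
  exists (z * a - a * z); split=> [||u v uv Muv]; first exact: L_bracket.
    by move=> Mza; apply: nMa.
  by rewrite -opprB mulrN mulNr; apply/(idealN idI)/Haz.
have [z [Lz nMz]] := descend _ (leqnn _).
rewrite subnn => /(_ [::] [::] erefl); rewrite big_nil mul1r mulr1 => Iz.
by apply/nMz/LIM; split=> //; apply: Iz.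
Qed.

(** With [K] fixed, the last clause of [P] concerns finitely many letters at a time, so it passes to
    unions of chains. Starting from the part of [L] in [I] supplies the inclusion that
    [exists_normalizing] requires. *)
Lemma engel_jacobson_bounded : words_in L I K.
Proof.
pose P M := [/\ M `<=` L, forall x y, M x -> M y -> M (x * y - y * x) &
  words_in M I K].
have [||M [[ML Mbr MK] LIM maxM]] := @Zorn_above A P (L `&` I).
- split=> [x []//|x y [Lx Ix] [Ly Iy]|].
    split; first exact: L_bracket.
    by apply: (idealB idI); apply: (idealMr idI).
  apply: (boundK (n := 1)) => -[|a []]// _ LIa; rewrite big_seq1.
  by case: (LIa a (mem_head _ _)).
- move=> C C0 CP totC.
  have chain s := @total_bigcup_seq _ C s C0 totC.
  split.
  + by move=> x [X /CP[XL _ _]] /XL.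
  + move=> x y Ux Uy; have [|X CX xyX] := chain [:: x; y].
      by move=> a; rewrite !inE => /orP[]/eqP->.
    have [_ Xbr _] := CP X CX; exists X => //.
    by apply: Xbr; apply: xyX; rewrite !inE eqxx ?orbT.
  + move=> w sw Uw; have [X CX wX] := chain w Uw.
    by have [_ _ XK] := CP X CX; apply: XK.
have [LM|/(exists_normalizing ML LIM MK)] := pselect (L `<=` M).
  by move=> w sw Lw; apply: MK => // a /Lw/LM.
case=> x [Lx nMx Mx].
case: nMx; apply: (maxM (M `|` [set x])); [by move=> y; left| |by right].
have [n xn0] := L_nil Lx; split.
- by move=> y [/ML//|->].
- move=> y z [My|->] [Mz|->]; left.
  + exact: Mbr.
  + by case: (Mx y My).
  + by case: (Mx z Mz).
  + by apply: LIM; split; [apply: L_bracket|rewrite subrr; apply: ideal0].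
- by apply: (words_in_add_normal _ xn0) => // a /Mx[].
Qed.

End EngelJacobson.

(** * Associative envelopes and the conclusion *)

Section AssocGen.
Variables (F : fieldType) (A : algType F) (I X : set A).
Hypothesis idI : is_ideal I.

Lemma assoc_gen_self : X `<=` assoc_gen X.
Proof.
move=> x Xx; exists 1%N, (fun=> 1), (fun=> [:: x]); split.
  by split=> // a; rewrite inE => /eqP->.
by rewrite big_ord1 big_seq1 scale1r.
Qed.

(** Words in a generated element are nonempty, so each factor lowers the [cowords] level by at least
    one, starting from [1] at level [n]. *)
Lemma words_in_assoc_gen n : words_in X I n -> words_in (assoc_gen X) I n.
Proof.
have word m v z : v <> [::] -> (forall a, a \in v -> X a) ->
    cowords I X m.+1 z -> cowords I X m ((\prod_(a <- v) a) * z).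
  move=> + + mz; elim: v => // a v IHv _ Xv.
  have Xa := Xv a (mem_head _ _).
  rewrite big_cons -mulrA; apply: cowordsMl => //.
  case: v IHv Xv => [|b v] IHv Xv; first by rewrite big_nil mul1r.
  apply: cowordsS => //; apply: IHv => // c cv.
  by apply: Xv; rewrite inE cv orbT.
have gen m a z : assoc_gen X a -> cowords I X m.+1 z -> cowords I X m (a * z).
  case=> r [c [v [Xv ->]]] mz; rewrite mulr_suml.
  apply: (big_ind (cowords I X m)) => [|x y|i _]; first exact: cowords_nil.
    exact: cowords_add.
  (* The scalar becomes a right factor in [A], absorbed by the right ideal [cowords I X m]. *)
  rewrite -scalerAl -mulr_algr; apply: cowordsMr => //.
  by case: (Xv i) => vi Xvi; apply: word.
move=> /(iffRL (cowords1 I X n)) X1 w sw Xw; apply/(cowords0 X idI).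
suff: forall m, (m + size w)%N = n -> cowords I X m (\prod_(a <- w) a).
  by apply.
elim: w {sw} Xw => [|a w IHw] Xw m; first by rewrite addn0 big_nil => ->.
rewrite /= -addSnnS big_cons => /IHw mw; apply: gen; first exact/Xw/mem_head.
by apply: mw => b bw; apply: Xw; rewrite inE bw orbT.
Qed.

End AssocGen.

Theorem theorem2p4 (F : finFieldType) (p : nat) (hp : p \in [pchar F])
    (A : algType F) (L : set A)
    (hL : is_lie_subalgebra L)
    (hnil : forall x : A, L x -> nilpotent_elt x)
    (hunits : solvable_group (units A) \/ bounded_engel (units A)) :
  locally_nilpotent (assoc_gen L).
Proof.
move=> _ /[swap] -[s ->] sL.
have idI := ideal_core A.
have [K boundK] :=
  group_identity_bound idI (@semiprime_coreP A) (@core_nil A) hunits.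
have LK := engel_jacobson_bounded idI boundK hL.2 hnil.
have [|m sm] := @words_in_core A s K.
  move=> w sw ws; apply: (words_in_assoc_gen idI LK) => // a /ws sa.
  exact/sL/assoc_gen_self.
(* The successor ensures a positive exponent, as [m] may be [0]. *)
exists m.+1 => //.
exact/(words_in_assoc_gen (is_ideal0 A))/(words_in_le (is_ideal0 A) _ sm).
Qed.
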